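(* Let $p$ be a prime and let $H$ be a finite group with $p\nmid |H|$. Then the independence number $\alpha(P(C_{p^\infty}\times H))$ of the power graph of $C_{p^\infty}\times H$ is equal to the number of cyclic subgroups of $H$.
   Context: The power graph $P(G)$ of a group $G$ is the undirected graph with vertex set $G$ in which two distinct elements are adjacent if and only if one of them is a positive power of the other. The independence number $\alpha(\Gamma)$ of a graph $\Gamma$ is the cardinality of a largest independent set (set of pairwise non-adjacent vertices). $C_{p^\infty}$ denotes the $p$-quasicyclic (Prüfer) group, i.e. the $p$-primary component of $\mathbb{Q}/\mathbb{Z}$. The trivial subgroup counts as a cyclic subgroup. *)

(* Defs.v *)
From HB Require Import structures.
From mathcomp Require Import all_boot all_order all_algebra.
From mathcomp Require Import all_fingroup all_solvable.
From mathcomp Require Import boolp classical_sets cardinality.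

Set Implicit Arguments.
Unset Strict Implicit.
Unset Printing Implicit Defensive.

Import GRing.Theory.

Section IndependenceNumber.
Local Open Scope card_scope.

(* A graph on V is given by its adjacency relation E; V may be infinite. *)
Variables (V : Type) (E : V -> V -> Prop).

Definition independent (A : set V) : Prop :=
  forall x y, A x -> A y -> ~ E x y.

Definition largest_independent (A : set V) : Prop :=
  independent A /\ forall B : set V, independent B -> B #<= A.

(* alpha(V, E) = n; a relation, since a largest independent set may fail to
   exist or be infinite. *)
Definition is_independence_number (n : nat) : Prop :=
  exists2 A : set V, largest_independent A & A #= `I_n.

End IndependenceNumber.

Section PowerGraph.
Local Open Scope group_scope.

Variable G : groupType.

Definition positive_power (x y : G) : Prop :=
  exists2 n : nat, (0 < n)%N & y = x ^+ n.

Definition power_graph (x y : G) : Prop :=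
  x <> y /\ (positive_power x y \/ positive_power y x).

End PowerGraph.

Section PrimaryComponent.
Local Open Scope ring_scope.

Variables (p : nat) (V : zmodType).

Definition primary_component : {pred V} :=
  [pred x | `[< exists n : nat, x *+ (p ^ n) = 0 >] ].

Fact primary_component_zmod_closed : zmod_closed primary_component.
Proof.
split=> [|x y /asboolP[m xm] /asboolP[n yn]]; apply/asboolP.
  by exists 0%N; rewrite mul0rn.
exists (m + n)%N; rewrite mulrnBl expnD mulrnA xm mul0rn.
by rewrite mulnC mulrnA yn mul0rn subr0.
Qed.

HB.instance Definition _ :=
  GRing.isZmodClosed.Build V primary_component primary_component_zmod_closed.

End PrimaryComponent.

Section Prufer.
Local Open Scope ring_scope.

Definition rat_int : {pred rat} := fun x => x \is a Num.int.

Fact rat_int_zmod_closed : zmod_closed rat_int.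
Proof. by split=> [|x y xZ yZ]; [exact: rpred0 | exact: rpredB]. Qed.

HB.instance Definition _ :=
  GRing.isZmodClosed.Build rat rat_int rat_int_zmod_closed.

Local Notation rat_mod_int := (Quotient.quot rat_int).

Variable p : nat.

Definition prufer_add : Type :=
  {x : rat_mod_int | x \in @primary_component p rat_mod_int}.

HB.instance Definition _ := Choice.on prufer_add.
HB.instance Definition _ := SubChoice.on prufer_add.
HB.instance Definition _ := [SubChoice_isSubZmodule of prufer_add by <:].

(* C_(p^oo) as a multiplicative group: its product is addition in Q/Z. *)
Definition prufer : groupType := Algebra.to_multiplicative prufer_add.

End Prufer.

(* Main.v *)
Require Import Defs.
From mathcomp Require Import all_boot all_order all_algebra.
From mathcomp Require Import all_fingroup all_solvable.
From mathcomp Require Import zify.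
From mathcomp Require Import boolp classical_sets cardinality.

Set Implicit Arguments.
Unset Strict Implicit.
Unset Printing Implicit Defensive.

Import GRing.Theory Num.Theory.

(** Write a vertex as (c, h), with c in the Pruefer group and h in H, and colour
    it by the cyclic subgroup <[h]> of H.

    Each colour class is a clique, which bounds every independent set by the
    number of colours.  Indeed the cyclic subgroups of the Pruefer group form a
    chain, so one of two elements c, c' is a power of the other
    ([prufer_chain]).  If also <[h]> = <[h']>, then h and h' are powers of each
    other, and since the orders of c and h are coprime, the Chinese remainder
    theorem merges the two exponents into one ([positive_power_pair],
    [power_graph_same_cycle]).

    Conversely, some choice of one vertex from each colour class is independent.
    The vertex chosen for a cyclic subgroup K pairs a generator of K with an
    element of order p ^ (#|H| - #|K|), so that the order of the first component
    strictly decreases when K grows.  If the vertex of L is a power of the vertex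
    of K, the second components give L \subset K, while the first components
    forbid #|L| < #|K|; hence L = K ([cyclic_rep_positive_power]).

    A colouring by cliques with an independent transversal determines the
    independence number ([is_independence_number_clique_cover]). *)

(** * Clique covers of a graph *)

Section CliqueCover.
Local Open Scope card_scope.
Local Open Scope classical_set_scope.

Lemma card_eq_finset (T : finType) (S : {set T}) : [set` S] #= `I_#|S|.
Proof.
rewrite (card_eq_trans _ (_ : [set: 'I_#|S|] #= _)) //; last first.
  by rewrite card_eq_sym card_II.
have <- : range (@enum_val T (mem S)) = [set` S].
  apply/seteqP; split=> [_ [i _ <-] | x xS] /=; first exact: enum_valP.
  by exists (enum_rank_in xS x); rewrite ?enum_rankK_in.
by apply: inj_card_eq => i j _ _ /enum_val_inj.
Qed.

(** An independent set meets each clique in at most one vertex, so [cls] is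
    injective on it; the transversal [rep @` S] attains the resulting bound. *)
Lemma is_independence_number_clique_cover (V : Type) (E : V -> V -> Prop)
    (T : finType) (S : {set T}) (cls : V -> T) (rep : T -> V) :
    (forall x, cls x \in S) ->
    (forall x y, cls x = cls y -> x <> y -> E x y) ->
    {in S, cancel rep cls} -> {in S &, forall K L, ~ E (rep K) (rep L)} ->
  is_independence_number E #|S|.
Proof.
move=> clsS clique repK repE.
have cardA : rep @` [set` S] #= [set` S].
  apply: inj_card_eq => K L; rewrite !inE => KS LS eqKL.
  by rewrite -(repK K KS) -(repK L LS) eqKL.
exists (rep @` [set` S]); last exact: card_eq_trans cardA (card_eq_finset S).
split=> [_ _ [K KS <-] [L LS <-] | B indepB]; first exact: repE.
have cls_inj : {in B &, injective cls}.
  move=> x y; rewrite !inE => xB yB eq_xy; apply: contrapT => neq_xy.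
  exact: indepB xB yB (clique _ _ eq_xy neq_xy).
rewrite -(card_le_eql (inj_card_eq cls_inj)) (card_le_eqr cardA).
by apply: subset_card_le => _ [x _ <-]; apply: clsS.
Qed.

End CliqueCover.

(** * Positive powers *)

Section Powers.
Local Open Scope group_scope.

Lemma expg_pair (G1 G2 : groupType) (x : G1 * G2) n :
  x ^+ n = (x.1 ^+ n, x.2 ^+ n).
Proof. by elim: n => // n IHn; rewrite !expgS IHn. Qed.

Lemma expg_modn (G : groupType) (x : G) m n :
  x ^+ m = 1 -> x ^+ (n %% m) = x ^+ n.
Proof.
by move=> xm; rewrite [in RHS](divn_eq n m) mulnC expgnDr expgnA xm expg1n mul1g.
Qed.

(** The congruence a * k = b modulo N is solvable exactly when [gcdn a N]
    divides b. *)
Lemma positive_power_gcd (G : groupType) (u : G) N a b :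
    (0 < N)%N -> u ^+ N = 1 -> (gcdn a N %| b)%N ->
  positive_power (u ^+ a) (u ^+ b).
Proof.
move=> N_gt0 uN.
(* Bezout coefficients in nat require a positive first argument. *)
have -> : u ^+ a = u ^+ (a + N) by rewrite expgnDr uN mulg1.
have <- : gcdn (a + N) N = gcdn a N by rewrite gcdnC gcdnDr gcdnC.
move=> /dvdnP[q ->].
case: (@egcdnP (a + N) N) => [|km kn def_gcd _]; first by rewrite addn_gt0 N_gt0 orbT.
(* The summand N only makes the exponent positive. *)
exists (km * q + N)%N; first by rewrite addn_gt0 N_gt0 orbT.
rewrite -expgnA.
have -> : ((a + N) * (km * q + N) = q * gcdn (a + N) N + N * (q * kn + (a + N)))%N.
  by rewrite mulnDr mulnA [((a + N) * km)%N]mulnC def_gcd; lia.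
by rewrite expgnDr (expgnA u N) uN expg1n mulg1.
Qed.

(** The gcds of a and b with p ^ n are both powers of p, so one divides the
    other. *)
Lemma positive_power_chain (G : groupType) (u : G) p n a b :
    prime p -> u ^+ (p ^ n) = 1 ->
  positive_power (u ^+ a) (u ^+ b) \/ positive_power (u ^+ b) (u ^+ a).
Proof.
move=> p_pr un; have pn_gt0 : (0 < p ^ n)%N by rewrite expn_gt0 prime_gt0.
have [i _ ga] := dvdn_pfactor (gcdn a (p ^ n)) n p_pr (dvdn_gcdr _ _).
have [j _ gb] := dvdn_pfactor (gcdn b (p ^ n)) n p_pr (dvdn_gcdr _ _).
have [le_ij | /ltnW le_ji] := leqP i j; [left | right].
  apply: positive_power_gcd un _ => //.
  by rewrite ga (dvdn_trans (dvdn_exp2l p le_ij)) // -gb dvdn_gcdl.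
apply: positive_power_gcd un _ => //.
by rewrite gb (dvdn_trans (dvdn_exp2l p le_ji)) // -ga dvdn_gcdl.
Qed.

(** Coprimality makes the exponents of the two components independent, by the
    Chinese remainder theorem. *)
Lemma positive_power_pair (G1 G2 : groupType) (x y : G1 * G2) N1 N2 :
    coprime N1 N2 -> (0 < N1)%N -> (0 < N2)%N ->
    x.1 ^+ N1 = 1 -> x.2 ^+ N2 = 1 ->
    positive_power x.1 y.1 -> positive_power x.2 y.2 ->
  positive_power x y.
Proof.
move=> co12 N1_gt0 N2_gt0 x1N x2N [n1 _ y1] [n2 _ y2].
(* The Chinese remainder may be 0; adding N1 * N2 makes it positive. *)
exists (chinese N1 N2 n1 n2 + N1 * N2)%N.
  by rewrite addn_gt0 muln_gt0 N1_gt0 N2_gt0 orbT.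
rewrite expg_pair [LHS]surjective_pairing; congr pair.
  rewrite expgnDr expgnA x1N expg1n mulg1 y1.
  by rewrite -(expg_modn n1 x1N) -(chinese_modl co12 n1 n2) expg_modn.
rewrite expgnDr mulnC expgnA x2N expg1n mulg1 y2.
by rewrite -(expg_modn n2 x2N) -(chinese_modr co12 n1 n2) expg_modn.
Qed.

End Powers.

(** * The Pruefer group *)

Section Prufer.

Local Notation rat_mod_int := (Quotient.quot rat_int).
Local Notation rat_class := (\pi_(rat_mod_int)%qT).

Lemma rat_class_eq (q r : rat) :
  (rat_class q == rat_class r) = ((q - r)%R \is a Num.int).
Proof. by rewrite -Quotient.idealrBE. Qed.

Lemma rat_class_eq0 (q : rat) : (rat_class q == 0%R) = (q \is a Num.int).
Proof. by rewrite -[0%R](raddf0 rat_class) rat_class_eq subr0. Qed.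

Lemma rat_class_root_subproof p n :
  rat_class ((p ^ n)%:R^-1)%R \in @primary_component p rat_mod_int.
Proof.
apply/asboolP; exists n; apply/eqP; rewrite -raddfMn rat_class_eq0.
(* If p ^ n = 0, the inverse is the default value 0, whose class is trivial. *)
rewrite -[(_^-1 *+ _)%R]mulr_natr; have [-> | nz] := eqVneq ((p ^ n)%:R : rat)%R 0%R.
  by rewrite mulr0 rpred0.
by rewrite mulVf ?rpred1.
Qed.

Definition prufer_root p n : prufer p :=
  exist _ (rat_class ((p ^ n)%:R^-1)%R) (rat_class_root_subproof p n).

Variable p : nat.

Lemma val_prufer_expg (x : prufer p) n : val (x ^+ n)%g = (val x *+ n)%R.
Proof. by elim: n => // n IHn; rewrite expgS mulrS -IHn. Qed.

Lemma prufer_torsion (x : prufer p) : exists n, (x ^+ (p ^ n) = 1)%g.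
Proof.
have /asboolP[n xn] := valP x; exists n.
by apply: val_inj; rewrite val_prufer_expg xn.
Qed.

Hypothesis p_pr : prime p.

Let pn_neq0 n : ((p ^ n)%:R != 0 :> rat)%R.
Proof. by rewrite pnatr_eq0 -lt0n expn_gt0 prime_gt0. Qed.

(** For every n, [prufer_root p n] has order exactly p ^ n: k / p ^ n is an
    integer if and only if p ^ n divides k. *)
Lemma prufer_root_expg_eq1 n k : (prufer_root p n ^+ k == 1)%g = (p ^ n %| k)%N.
Proof.
rewrite -val_eqE val_prufer_expg /= -raddfMn rat_class_eq0 -[(_ *+ _)%R]mulr_natl.
apply/idP/idP => [/intrP[z def_z] | /dvdnP[q ->]]; last first.
  by rewrite natrM mulfK ?pn_neq0 // rpred_nat.
have : (k%:R = z%:~R * (p ^ n)%:R :> rat)%R by rewrite -def_z mulfVK.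
rewrite !pmulrn -intrM => /intr_inj def_k.
by rewrite -[(_ %| _)%N]/((p ^ n)%:Z %| k%:Z)%Z def_k dvdz_mull.
Qed.

Lemma prufer_root_expg_pn n : (prufer_root p n ^+ (p ^ n) = 1)%g.
Proof. by apply/eqP; rewrite prufer_root_expg_eq1. Qed.

(** If q * p ^ n is an integer z, then q is congruent modulo 1 to a / p ^ n,
    where a is the remainder of z modulo p ^ n. *)
Lemma prufer_root_gen (x : prufer p) n :
  (x ^+ (p ^ n) = 1)%g -> exists a, x = (prufer_root p n ^+ a)%g.
Proof.
move=> /eqP; rewrite -val_eqE val_prufer_expg -[val x]reprK /=.
set q := generic_quotient.repr _; rewrite -raddfMn rat_class_eq0 => /intrP[z def_z].
exists `|(z %% (p ^ n)%:Z)%Z|%N; apply: val_inj; apply/eqP.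
rewrite val_prufer_expg -[val x]reprK -/q /= -raddfMn rat_class_eq.
suff -> : (q - (p ^ n)%:R^-1 *+ `|(z %% (p ^ n)%:Z)%Z| = (z %/ (p ^ n)%:Z)%Z%:~R)%R.
  exact: rpred_int.
apply: (mulIf (pn_neq0 n)); rewrite mulrBl mulrnAl mulVf ?pn_neq0 //.
rewrite mulr_natr def_z [X in (X%:~R - _)%R](divz_eq z (p ^ n)%:Z).
rewrite intrD intrM /= natr_absz ger0_norm ?addrK // modz_ge0 //.
by rewrite eqz_nat -lt0n expn_gt0 prime_gt0.
Qed.

(** Any two elements are powers of a common [prufer_root p n], whose powers
    are pairwise comparable. *)
Lemma prufer_chain (x y : prufer p) : positive_power x y \/ positive_power y x.
Proof.
have [m xm] := prufer_torsion x; have [n yn] := prufer_torsion y.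
have [a ->] : exists a, x = (prufer_root p (m + n) ^+ a)%g.
  by apply: prufer_root_gen; rewrite expnD expgnA xm expg1n.
have [b ->] : exists b, y = (prufer_root p (m + n) ^+ b)%g.
  by apply: prufer_root_gen; rewrite expnD mulnC expgnA yn expg1n.
by apply: (@positive_power_chain _ _ p (m + n)); rewrite ?prufer_root_expg_pn.
Qed.

End Prufer.

(** * Cyclic subgroups of H *)

Section CyclicRepresentatives.
Local Open Scope group_scope.

Variable H : finGroupType.

Definition cyclic_gen (K : {group H}) : H :=
  odflt 1 [pick x | generator K x].

Lemma cycle_cyclic_gen (K : {group H}) : cyclic K -> <[cyclic_gen K]>%G = K.
Proof.
move=> cycK; apply: val_inj; rewrite /= /cyclic_gen.
case: pickP => [x /eqP-> // | noK]; have /cyclicP[x defK] := cycK.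
by have:= noK x; rewrite /generator defK eqxx.
Qed.

Lemma positive_power_cycle_eq (h h' : H) : <[h]> = <[h']> -> positive_power h h'.
Proof.
move=> eq_hh'; have /cycleP[n ->] : h' \in <[h]> by rewrite eq_hh' cycle_id.
exists (n + #[h])%N; first by rewrite addn_gt0 order_gt0 orbT.
by rewrite expgD expg_order mulg1.
Qed.

Variable p : nat.
Hypothesis p_pr : prime p.

Lemma power_graph_same_cycle (x y : prufer p * H) :
    ~~ (p %| #|H|)%N -> <[x.2]> = <[y.2]> -> x <> y -> power_graph x y.
Proof.
move=> p'H.
have pos (x' y' : prufer p * H) :
    <[x'.2]> = <[y'.2]> -> positive_power x'.1 y'.1 -> positive_power x' y'.
  move=> eq2 pow1; have [n x1n] := prufer_torsion x'.1.
  apply: (@positive_power_pair _ _ _ _ (p ^ n) #[x'.2]) => //.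
  - rewrite coprimeXl // prime_coprime //; apply: contra p'H => /dvdn_trans-> //.
    by rewrite -cardsT order_dvdG ?inE.
  - by rewrite expn_gt0 prime_gt0.
  - exact: expg_order.
  exact: positive_power_cycle_eq.
move=> eq2 neq_xy; split=> //.
by case: (prufer_chain p_pr x.1 y.1) => [xy | yx]; [left | right]; apply: pos.
Qed.

(** Larger subgroups get first components of smaller order, so that inclusions
    in the two components run in opposite directions. *)
Definition cyclic_rep (K : {group H}) : prufer p * H :=
  (prufer_root p (#|H| - #|K|), cyclic_gen K).

Lemma cyclic_rep_positive_power (K L : {group H}) :
  cyclic K -> cyclic L -> positive_power (cyclic_rep K) (cyclic_rep L) -> K = L.
Proof.
move=> cycK cycL [n _]; rewrite expg_pair /= => -[root_eq gen_eq].
apply/eqP; rewrite eq_sym -val_eqE eqEproper.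
have -> /= : L \subset K.
  by rewrite -(cycle_cyclic_gen cycL) -(cycle_cyclic_gen cycK) gen_eq cycleX.
apply/negP => /proper_card ltLK.
have ltKL : (#|H| - #|K| < #|H| - #|L|)%N.
  by rewrite ltn_sub2l // (leq_trans ltLK) // -cardsT subset_leq_card ?subsetT.
have: (prufer_root p (#|H| - #|L|) ^+ (p ^ (#|H| - #|K|)) == 1).
  by rewrite root_eq expgnAC prufer_root_expg_pn ?expg1n.
by rewrite prufer_root_expg_eq1 // dvdn_Pexp2l ?prime_gt1 // leqNgt ltKL.
Qed.

End CyclicRepresentatives.

Theorem mainTheorem3 (p : nat) (H : finGroupType) :
  prime p -> ~~ (p %| #|H|) ->
  is_independence_number (@power_graph (prufer p * H)%type)
    #|[set K : {group H} | cyclic K]|.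
Proof.
move=> p_pr p'H.
apply: (@is_independence_number_clique_cover _ _ _ _
          (fun x => <[x.2]>%G) (cyclic_rep p)).
- by move=> x; rewrite inE cycle_cyclic.
- by move=> x y /(congr1 val) /= eq2; apply: power_graph_same_cycle.
- by move=> K; rewrite inE => cycK; apply: cycle_cyclic_gen.
move=> K L; rewrite !inE => cycK cycL [neqKL [KL | LK]]; case: neqKL.
  by rewrite (cyclic_rep_positive_power p_pr cycK cycL KL).
by rewrite (cyclic_rep_positive_power p_pr cycL cycK LK).
Qed.
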